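(* Let $(\theta_n)_{n\ge1}$ be a sequence with $\theta_n\in(0,1]$ for all $n$, and let $\pi=\pi_n$ be the probability distribution on $\{0,1\}^n$ given by $\pi(x)=\theta_n^{S(x)}(1+\theta_n)^{-n}$. Then the sequence, indexed by $n$, of lazy random walk Metropolis chains for $\pi_n$ on $\{0,1\}^n$ has cutoff at $$\frac{2}{1+\theta_n}\,n\,\min\left\{\log n,\ \log\sqrt{n/\theta_n}\right\}$$ with a window of size $n$.
   Context: For $x\in\{0,1\}^n$, $S(x)=\sum_{i=1}^n x_i$ is the number of ones in $x$. Two states are neighbors, $x\sim y$, if they differ in exactly one coordinate. Lazy random walk Metropolis chain for a positive distribution $\pi$ on $\{0,1\}^n$: at each step, flip an independent fair coin. If heads, stay at the current state $x$. If tails, choose one of the $n$ neighbors $y$ of $x$ uniformly at random, move to $y$ with probability $\min(1,\pi(y)/\pi(x))$, and otherwise stay at $x$. For $\pi(x)=\theta_n^{S(x)}(1+\theta_n)^{-n}$ with $\theta_n\in(0,1]$, the transition matrix is: $P(x,y)=\frac1{2n}$ if $x\sim y$ and $S(x)>S(y)$; $P(x,y)=\frac{\theta_n}{2n}$ if $x\sim y$ and $S(x)<S(y)$; $P(x,x)=\frac12+\frac{n-S(x)}{2n}(1-\theta_n)$; and $P(x,y)=0$ otherwise. Total variation distance: $\|\mu-\nu\|=\max_A(\mu(A)-\nu(A))$. For the $n$-th chain, $d_n(t)=\max_x\|P^t(x,\cdot)-\pi\|$ for $t=0,1,2,\dots$ (non-integer times are rounded to integers, e.g. down). A sequence of chains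 has cutoff at $s_n$ with window size $w_n$ if $w_n=o(s_n)$, $\lim_{\alpha\to\infty}\liminf_{n\to\infty}d_n(s_n-\alpha w_n)=1$, and $\lim_{\alpha\to\infty}\limsup_{n\to\infty}d_n(s_n+\alpha w_n)=0$. *)

(* Defs.v *)
From HB Require Import structures.
From mathcomp Require Import all_boot all_order all_algebra.
From mathcomp Require Import all_classical all_reals all_analysis.
Set Implicit Arguments.
Unset Strict Implicit.
Unset Printing Implicit Defensive.
Import Order.TTheory GRing.Theory Num.Theory.
Import numFieldNormedType.Exports.
Local Open Scope classical_set_scope.
Local Open Scope ring_scope.

Section FiniteChains.
Variables (R : realType) (T : finType).
Implicit Types (mu nu : T -> R) (P : T -> T -> R).

Fixpoint transition_power P (t : nat) (x y : T) : R :=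
  if t is t'.+1 then \sum_(z : T) P x z * transition_power P t' z y
  else (x == y)%:R.

(* The default value 0 is harmless: A = set0 contributes 0 to the maximum. *)
Definition tv_dist mu nu : R :=
  \big[Num.max/0]_(A : {set T}) (\sum_(x in A) mu x - \sum_(x in A) nu x).

(* The default value 0 is harmless when T is inhabited, as tv_dist is
   nonnegative. *)
Definition worst_dist P nu (t : nat) : R :=
  \big[Num.max/0]_(x : T) tv_dist (transition_power P t x) nu.

(* Real times are rounded down; Num.truncn sends negative reals to 0, but the
   times s_n - alpha * w_n used below are eventually positive in n because
   w = o(s) for s positive. *)
Definition worst_dist_real P nu (t : R) : R := worst_dist P nu (Num.truncn t).

End FiniteChains.

Definition has_cutoff (R : realType) (T : nat -> finType)
    (P : forall n, T n -> T n -> R) (nu : forall n, T n -> R)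
    (s w : nat -> R) : Prop :=
  [/\ w =o_\oo s,
      limn_einf (fun n => (worst_dist_real (P n) (nu n) (s n - a * w n))%:E)
        @[a --> +oo%R] --> 1%E &
      limn_esup (fun n => (worst_dist_real (P n) (nu n) (s n + a * w n))%:E)
        @[a --> +oo%R] --> 0%E].

Section Hypercube.
Variables (R : realType) (n : nat).
Implicit Types x y : {ffun 'I_n -> bool}.

Definition ones x : nat := #|[pred i | x i]|.

Definition neighbor x y : bool := #|[pred i | x i != y i]| == 1%N.

Definition acceptance (nu : {ffun 'I_n -> bool} -> R) x y : R :=
  Num.min 1 (nu y / nu x).

(* The holding probability adds the fair coin and the rejected proposals.
   For n = 0 there is no neighbor to propose and this is not a stochastic
   matrix. *)
Definition lazy_metropolis (nu : {ffun 'I_n -> bool} -> R) x y : R :=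
  if x == y then
    2^-1 + 2^-1 * \sum_(z | neighbor x z) n%:R^-1 * (1 - acceptance nu x z)
  else if neighbor x y then 2^-1 * (n%:R^-1 * acceptance nu x y)
  else 0.

Definition product_dist (theta : R) x : R :=
  theta ^+ ones x * (1 + theta) ^- n.

End Hypercube.

(* Main.v *)
Require Import Defs.
From HB Require Import structures.
From mathcomp Require Import all_boot all_order all_algebra.
From mathcomp Require Import all_classical all_reals all_analysis.
From mathcomp Require Import ring lra.
Set Implicit Arguments.
Unset Strict Implicit.
Unset Printing Implicit Defensive.
Import Order.TTheory GRing.Theory Num.Theory.
Import numFieldNormedType.Exports.
Local Open Scope classical_set_scope.
Local Open Scope ring_scope.

(** Write [theta] for [theta n]. The chain picks a uniform coordinate and moves
    it by a two-state chain that leaves 1 with probability 1/2 and leaves 0 with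
    probability [theta / 2]. The two-state chain has the eigenfunction
    1 -> 1, 0 -> [- theta], so the products of this function over the subsets
    [S] of the coordinates form an orthogonal eigenbasis on the cube, with
    eigenvalues [1 - #|S| gap], where [gap = (1 + theta) / (2 n)]. With [s] the
    announced cutoff time, [s * gap = min (ln n) (ln (sqrt (n / theta)))].

    Two different upper bounds produce the two terms of the minimum. The
    operator contracts the oscillation of a function along every coordinate by
    the factor [1 - gap]; since an indicator oscillates by at most 1 along
    each of the [n] coordinates, the distance at time [t] is at most
    [n (1 - gap) ^ t] ([worst_dist_contract]), which is small [C n] steps after
    [ln n / gap], whatever [theta] is. On the other hand, the [L2] norm of the
    density, read off the eigenbasis, gives the bound
    [sqrt (exp (n exp (- 2 t gap) / theta) - 1)] ([worst_dist_spectral]), small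
    [C n] steps after [ln (sqrt (n / theta)) / gap].

    A single lower bound matches both. Start from all ones and look at the sum
    over the coordinates of the two-state eigenfunction. At time [t] it has mean
    [m = n (1 - gap) ^ t] and variance at most [n theta + m]; at equilibrium it
    has mean 0 and variance [n theta]. By Chebyshev's inequality the two laws
    are far apart as long as [m] is large compared with both 1 and
    [sqrt (n theta)] ([worst_dist_lower]), and [C n] steps before [s] it exceeds
    both by a factor at least of order [exp (C / 2)].

    Hence, at times [s + a n] and [s - a n], the distance is within a constant
    times [exp (- a / 2)] of 0 and of 1, uniformly in large [n]. *)

(** * Finite chains and total variation *)

Section Chains.
Variables (R : realType) (T : finType).
Implicit Types (P : T -> T -> R) (mu nu f : T -> R) (A : {set T}).

(** The action of the [t]-th power of [P] on functions. Recursing on the first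
    step matches [transition_power], so that facts on one step of [P] applied to
    a function iterate directly. *)
Definition expect_after P (t : nat) f (x : T) : R :=
  \sum_y transition_power P t x y * f y.

Lemma expect_after0 P f x : expect_after P 0 f x = f x.
Proof.
rewrite /expect_after (bigD1 x)//= eqxx mul1r big1 ?addr0// => y yx.
by rewrite eq_sym (negbTE yx) mul0r.
Qed.

Lemma expect_afterS P t f x :
  expect_after P t.+1 f x = \sum_z P x z * expect_after P t f z.
Proof.
rewrite /expect_after /=.
under eq_bigr do rewrite mulr_suml.
rewrite exchange_big; apply: eq_bigr => z _.
by rewrite mulr_sumr; apply: eq_bigr => y _; rewrite mulrA.
Qed.

Lemma expect_after_sum P t (I : finType) (Q : pred I) (F : I -> T -> R) x :
  expect_after P t (fun y => \sum_(i | Q i) F i y) x =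
  \sum_(i | Q i) expect_after P t (F i) x.
Proof.
rewrite exchange_big; apply: eq_bigr => y _; by rewrite mulr_sumr.
Qed.

Lemma expect_afterD P t f g x :
  expect_after P t (fun y => f y + g y) x =
  expect_after P t f x + expect_after P t g x.
Proof. by rewrite -big_split; apply: eq_bigr => y _; rewrite mulrDr. Qed.

Lemma expect_afterZ P t c f x :
  expect_after P t (fun y => c * f y) x = c * expect_after P t f x.
Proof. by rewrite mulr_sumr; apply: eq_bigr => y _; rewrite mulrCA. Qed.

Lemma eq_expect_after P t f g x :
  f =1 g -> expect_after P t f x = expect_after P t g x.
Proof. by move=> fg; apply: eq_bigr => y _; rewrite fg. Qed.

Lemma expect_after_eigen P lam f t x :
  (forall x, \sum_z P x z * f z = lam * f x) ->
  expect_after P t f x = lam ^+ t * f x.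
Proof.
move=> Pf; elim: t x => [|t IH] x; first by rewrite expect_after0 expr0 mul1r.
rewrite expect_afterS; under eq_bigr do rewrite IH mulrCA.
by rewrite -mulr_sumr Pf mulrA -exprSr.
Qed.

Lemma expect_after_const P t c x :
  (forall x, \sum_y P x y = 1) -> expect_after P t (fun=> c) x = c.
Proof.
move=> P1; have Pc z : \sum_y P z y * c = 1 * c by rewrite -mulr_suml P1.
by rewrite (expect_after_eigen _ _ Pc) expr1n mul1r.
Qed.

Lemma transition_power_sum1 P t x :
  (forall x, \sum_y P x y = 1) -> \sum_y transition_power P t x y = 1.
Proof.
move=> P1; rewrite -[RHS](expect_after_const t 1 x P1).
by apply: eq_bigr => y _; rewrite mulr1.
Qed.

Lemma expect_after_stationary P nu f t :
  (forall f, \sum_x nu x * (\sum_z P x z * f z) = \sum_x nu x * f x) ->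
  \sum_x nu x * expect_after P t f x = \sum_x nu x * f x.
Proof.
move=> nuP; elim: t => [|t IH].
  by apply: eq_bigr => x _; rewrite expect_after0.
by under eq_bigr do rewrite expect_afterS; rewrite nuP.
Qed.

Lemma expect_after_indicator P t A x :
  expect_after P t (fun y => (y \in A)%:R) x =
  \sum_(y in A) transition_power P t x y.
Proof.
rewrite big_mkcond; apply: eq_bigr => y _.
by case: (y \in A); rewrite ?mulr1 ?mulr0.
Qed.

Lemma transition_power_ge0 P t x y :
  (forall x y, 0 <= P x y) -> 0 <= transition_power P t x y.
Proof.
move=> P0; elim: t x => [|t IH] x /=; first exact: ler0n.
by apply: sumr_ge0 => z _; rewrite mulr_ge0.
Qed.

Lemma tv_dist_ge mu nu A :
  \sum_(x in A) mu x - \sum_(x in A) nu x <= tv_dist mu nu.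
Proof.
pose F A := \sum_(x in A) mu x - \sum_(x in A) nu x.
exact: (le_bigmax _ F).
Qed.

Lemma tv_dist_le mu nu c : 0 <= c ->
  (forall A, \sum_(x in A) mu x - \sum_(x in A) nu x <= c) ->
  tv_dist mu nu <= c.
Proof. by move=> c0 Ac; apply: bigmax_le. Qed.

Lemma worst_dist_ge P nu t x :
  tv_dist (transition_power P t x) nu <= worst_dist P nu t.
Proof. exact: (le_bigmax _ (fun x => tv_dist (transition_power P t x) nu)). Qed.

Lemma worst_dist_le P nu t c : 0 <= c ->
  (forall x, tv_dist (transition_power P t x) nu <= c) ->
  worst_dist P nu t <= c.
Proof. by move=> c0 Ac; apply: bigmax_le. Qed.

Lemma worst_dist_ge0 P nu t : 0 <= worst_dist P nu t.
Proof. exact: bigmax_ge_id. Qed.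

Lemma worst_dist_le1 P nu t :
  (forall x, 0 <= nu x) -> (forall x y, 0 <= P x y) ->
  (forall x, \sum_y P x y = 1) -> worst_dist P nu t <= 1.
Proof.
move=> nu0 P0 P1; apply: worst_dist_le => // x; apply: tv_dist_le => // A.
have mu0 y := transition_power_ge0 t x y P0.
have mu1 := transition_power_sum1 t x P1.
rewrite lerBlDr (@le_trans _ _ 1)//; last by rewrite lerDl sumr_ge0.
rewrite -mu1 big_mkcond /=; apply: ler_sum => y _.
by case: ifP.
Qed.

(** The event testing the two laws is that [f] is at least [a / 2], halfway
    between the centers 0 and [a]: the event under [nu], and its complement under
    [mu], require a deviation of at least [a / 2] from the center. *)
Lemma tv_dist_chebyshev mu nu f a V W : 0 < a ->
  (forall x, 0 <= mu x) -> (forall x, 0 <= nu x) -> \sum_x mu x = 1 ->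
  \sum_x mu x * (f x - a) ^+ 2 <= V -> \sum_x nu x * f x ^+ 2 <= W ->
  1 - 4 * (V + W) / a ^+ 2 <= tv_dist mu nu.
Proof.
move=> a0 mu0 nu0 mu1 muV nuW.
pose A := [set x | a / 2 <= f x]%SET.
apply: le_trans (tv_dist_ge mu nu A).
have a2 : 0 < a ^+ 2 by rewrite exprn_gt0.
have nuA : \sum_(x in A) nu x <= 4 / a ^+ 2 * W.
  apply: (@le_trans _ _ (4 / a ^+ 2 * \sum_x nu x * f x ^+ 2)); last first.
    by rewrite ler_pM2l// divr_gt0.
  rewrite mulr_sumr big_mkcond; apply: ler_sum => x _; rewrite inE.
  case: ifP => [fx|_]; last first.
    by apply: mulr_ge0; [rewrite divr_ge0 ?sqr_ge0|rewrite mulr_ge0 ?sqr_ge0].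
  rewrite mulrCA -[leLHS]mulr1 ler_wpM2l// mulrAC ler_pdivlMr// mul1r.
  by nra.
have muA : \sum_(x | x \notin A) mu x <= 4 / a ^+ 2 * V.
  apply: (@le_trans _ _ (4 / a ^+ 2 * \sum_x mu x * (f x - a) ^+ 2)); last first.
    by rewrite ler_pM2l// divr_gt0.
  rewrite mulr_sumr big_mkcond; apply: ler_sum => x _; rewrite inE -ltNge.
  case: ifP => [fx|_]; last first.
    by apply: mulr_ge0; [rewrite divr_ge0 ?sqr_ge0|rewrite mulr_ge0 ?sqr_ge0].
  rewrite mulrCA -[leLHS]mulr1 ler_wpM2l// mulrAC ler_pdivlMr// mul1r.
  by nra.
have := mu1; rewrite (bigID (mem A)) /= => mu1'.
have -> : 4 * (V + W) / a ^+ 2 = 4 / a ^+ 2 * V + 4 / a ^+ 2 * W by ring.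
lra.
Qed.

End Chains.

(** * The single-site description of the chain *)

Section Cube.
Variables (R : realType) (n : nat) (theta : R).
Hypotheses (n_gt0 : (0 < n)%N) (theta_gt0 : 0 < theta) (theta_le1 : theta <= 1).

Local Notation state := {ffun 'I_n -> bool}.
Implicit Types (x y z : state) (i j : 'I_n) (S : {set 'I_n}) (f : state -> R)
  (A : {set state}).

Local Notation stat := (product_dist (n := n) theta).
Local Notation P := (lazy_metropolis stat).

Definition flip x i : state := [ffun j => if j == i then ~~ x j else x j].

Lemma flipE x i j : flip x i j = if j == i then ~~ x j else x j.
Proof. by rewrite ffunE. Qed.

Lemma flipK i : involutive (flip^~ i).
Proof.
by move=> x; apply/ffunP => j; rewrite !flipE; case: (j == i); rewrite ?negbK.
Qed.

Lemma flipC x i j : flip (flip x i) j = flip (flip x j) i.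
Proof. by apply/ffunP => k; rewrite !flipE; do 2 case: ifP. Qed.

Lemma sum_neighbor x (F : state -> R) :
  \sum_(z | neighbor x z) F z = \sum_i F (flip x i).
Proof.
have -> : \sum_(z | neighbor x z) F z = \sum_(z in [set flip x i | i : 'I_n]) F z.
  apply: eq_bigl => z; apply/idP/imsetP => [|[i _ ->]].
    move=> /card1P[i xz]; exists i => //; apply/ffunP => j; rewrite flipE.
    have := xz j; rewrite !inE => <-.
    by case: eqVneq => [->//|/=]; case: (x j); case: (z j).
  apply/card1P; exists i => j; rewrite !inE flipE.
  by case: (j == i); case: (x j).
rewrite big_imset//= => i j _ _ /ffunP/(_ i); rewrite !flipE eqxx.
by case: eqVneq => //= _; case: (x i).
Qed.

Definition site_weight (b : bool) : R := (if b then theta else 1) / (1 + theta).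

Lemma theta1_gt0 : 0 < 1 + theta. Proof. by rewrite addr_gt0. Qed.
Lemma theta1_neq0 : 1 + theta != 0. Proof. by rewrite gt_eqF// theta1_gt0. Qed.

Lemma site_weight_gt0 b : 0 < site_weight b.
Proof. by rewrite divr_gt0 ?theta1_gt0//; case: b. Qed.

Lemma product_distE x : stat x = \prod_i site_weight (x i).
Proof.
rewrite /product_dist /site_weight big_split /= prodr_const card_ord exprVn.
congr (_ * _); rewrite /ones -big_mkcond /= prodr_const.
by congr (_ ^+ _); apply: eq_card.
Qed.

Lemma product_dist_gt0 x : 0 < stat x.
Proof. by rewrite product_distE prodr_gt0// => i _; exact: site_weight_gt0. Qed.

(** The coordinates are independent under the product distribution. *)
Lemma expect_prod (G : 'I_n -> bool -> R) :
  \sum_x stat x * \prod_i G i (x i) =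
  \prod_i (site_weight true * G i true + site_weight false * G i false).
Proof.
under [RHS]eq_bigr do rewrite -(big_bool _ (fun b => site_weight b * G _ b)).
rewrite bigA_distr_bigA /=; apply: eq_bigr => x _.
by rewrite product_distE -big_split.
Qed.

Lemma site_weight_sum : site_weight true + site_weight false = 1.
Proof. by rewrite /site_weight; field; exact: theta1_neq0. Qed.

Lemma sum_product_dist : \sum_x stat x = 1.
Proof.
transitivity (\sum_x stat x * \prod_(i < n) (fun=> 1 : R) (x i)).
  by apply: eq_bigr => x _; rewrite big1 ?mulr1.
rewrite (expect_prod (fun _ => fun=> 1)) big1// => i _.
by rewrite !mulr1 site_weight_sum.
Qed.

(** Probability of accepting a proposal to change a site that is at [b]. *)
Definition rate (b : bool) : R := if b then 1 else theta.

Lemma product_dist_flip x i :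
  stat (flip x i) * site_weight (x i) = stat x * site_weight (~~ x i).
Proof.
rewrite !product_distE (bigD1 i)//= [X in _ = X * _](bigD1 i)//= flipE eqxx.
under eq_bigr => j ji do rewrite flipE (negbTE ji).
ring.
Qed.

Lemma acceptance_flip x i : acceptance stat x (flip x i) = rate (x i).
Proof.
have -> : acceptance stat x (flip x i) =
    Num.min 1 (site_weight (~~ x i) / site_weight (x i)).
  have s0 := lt0r_neq0 (product_dist_gt0 x).
  have w0 := lt0r_neq0 (site_weight_gt0 (x i)).
  congr (Num.min _ _); apply/eqP; rewrite eqr_div//; apply/eqP.
  by rewrite product_dist_flip mulrC.
have t0 := theta_gt0; have t1 := theta1_neq0.
rewrite /site_weight /rate; case: (x i) => /=.
  have -> : 1 / (1 + theta) / (theta / (1 + theta)) = theta^-1.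
    by field; rewrite t1 gt_eqF.
  by apply/min_idPl; rewrite invf_ge1.
have -> : theta / (1 + theta) / (1 / (1 + theta)) = theta by field.
exact/min_idPr.
Qed.

(** The form of the chain on which all the estimates rely: one step is a sum
    over the coordinates of single-site moves. The holding probability
    disappears because the rows of the kernel sum to 1. *)
Lemma generatorE f x : \sum_z P x z * f z =
  f x + (2 * n%:R)^-1 * \sum_i rate (x i) * (f (flip x i) - f x).
Proof.
have n0 : n%:R != 0 :> R by rewrite pnatr_eq0 -lt0n.
rewrite (bigD1 x)//= {1}/lazy_metropolis eqxx.
have -> : \sum_(z | neighbor x z) n%:R^-1 * (1 - acceptance stat x z) =
    \sum_i n%:R^-1 * (1 - rate (x i)).
  by rewrite sum_neighbor; apply: eq_bigr => i _; rewrite acceptance_flip.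
have -> : \sum_(z | z != x) P x z * f z =
    \sum_(z | neighbor x z) 2^-1 * (n%:R^-1 * acceptance stat x z) * f z.
  rewrite [LHS]big_mkcond [RHS]big_mkcond /=; apply: eq_bigr => z _.
  rewrite /lazy_metropolis eq_sym; case: eqVneq => [<-|_] /=.
    rewrite ifF//; apply/negbTE; rewrite /neighbor.
    by rewrite eq_card0// => i; rewrite !inE eqxx.
  by case: ifP => // _; rewrite mul0r.
rewrite sum_neighbor; under [X in _ + X]eq_bigr do rewrite acceptance_flip.
rewrite !mulr_sumr.
have {1}-> : (2^-1 : R) = \sum_(i < n) 2^-1 / n%:R.
  by rewrite sumr_const card_ord -mulr_natr; field.
rewrite -big_split /= mulr_suml.
have {2}-> : f x = \sum_(i < n) f x / n%:R.
  by rewrite sumr_const card_ord -mulr_natr; field.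
rewrite -!big_split /=; apply: eq_bigr => i _.
by field.
Qed.

Lemma lazy_metropolis_ge0 x y : 0 <= P x y.
Proof.
have acc0 z : 0 <= acceptance stat x z.
  by rewrite le_min ler01 divr_ge0// ltW// product_dist_gt0.
rewrite /lazy_metropolis; case: ifP => _; last by case: ifP => // _; rewrite !mulr_ge0.
rewrite addr_ge0// mulr_ge0//; apply: sumr_ge0 => z _.
by rewrite mulr_ge0// subr_ge0 ge_min lexx.
Qed.

Lemma lazy_metropolis_sum1 x : \sum_y P x y = 1.
Proof.
have := generatorE (fun=> 1) x; under eq_bigr do rewrite mulr1.
by move=> ->; rewrite big1 ?mulr0 ?addr0// => i _; rewrite subrr mulr0.
Qed.

Lemma detailed_balance x i : stat (flip x i) * rate (~~ x i) = stat x * rate (x i).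
Proof.
have := product_dist_flip x i; have := theta1_neq0.
rewrite /site_weight /rate; case: (x i) => /= t0 /(congr1 (fun r => r * (1 + theta))).
  by rewrite -!mulrA !mulVf// !mulr1.
by rewrite -!mulrA !mulVf// !mulr1.
Qed.

(** Summed against the product distribution, the [i]-th term of the generator
    cancels by detailed balance, after exchanging each state with its flip. *)
Lemma product_dist_stationary f :
  \sum_x stat x * (\sum_z P x z * f z) = \sum_x stat x * f x.
Proof.
under eq_bigr do rewrite generatorE mulrDr.
rewrite big_split /= -[RHS]addr0; congr (_ + _).
under eq_bigr do rewrite mulrCA mulr_sumr; rewrite -mulr_sumr exchange_big /=.
rewrite big1 ?mulr0// => i _.
under eq_bigr do rewrite mulrA mulrBr; rewrite sumrB.
apply/eqP; rewrite subr_eq0; apply/eqP.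
rewrite (reindex_inj (can_inj (flipK i))) /=; apply: eq_bigr => x _.
by rewrite flipK flipE eqxx detailed_balance.
Qed.

(** * Contraction along the coordinates *)

(** The spectral gap, which is also the rate of contraction. *)
Definition gap : R := (1 + theta) / (2 * n%:R).

Lemma gap_le1 : gap <= 1.
Proof.
rewrite ler_pdivrMr ?mulr_gt0 ?ltr0n// mul1r.
have : 1 <= n%:R :> R by rewrite ler1n.
have := theta_le1; lra.
Qed.

(** Moves at a coordinate other than [i] commute with [flip^~ i] and have the
    same rate before and after it, so they only average the oscillation along
    [i]. A move at [i] multiplies it by the second eigenvalue [(1 - theta) / 2]
    of the two-state chain. Picking [i] with probability [1 / n] gives the
    factor [1 - (1 - (1 - theta) / 2) / n = 1 - gap]. *)
Lemma generator_contract f i L :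
  (forall x, `|f (flip x i) - f x| <= L) ->
  forall x, `|\sum_z P (flip x i) z * f z - \sum_z P x z * f z| <= (1 - gap) * L.
Proof.
move=> fL x; rewrite !generatorE.
have n0 : n%:R != 0 :> R by rewrite pnatr_eq0 -lt0n.
have n1 : 0 < n%:R :> R by rewrite ltr0n.
pose D y := f (flip y i) - f y.
(* D is the increment along i; E sums its averages over the moves at j != i. *)
pose E := \sum_(j | j != i)
  ((1 - rate (x j) / 2) * D x + rate (x j) / 2 * D (flip x j)).
have -> : f (flip x i) + (2 * n%:R)^-1 *
      (\sum_j rate (flip x i j) * (f (flip (flip x i) j) - f (flip x i))) -
    (f x + (2 * n%:R)^-1 * \sum_j rate (x j) * (f (flip x j) - f x)) =
    n%:R^-1 * ((1 - theta) / 2 * D x + E).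
  have -> : f (flip x i) = f x + D x by rewrite /D addrC subrK.
  rewrite [X in _ + _ * X - _](bigD1 i)//= [X in _ - (_ + _ * X)](bigD1 i)//=.
  rewrite flipK flipE eqxx.
  have -> : rate (~~ x i) * (f x - (f x + D x)) = rate (x i) * D x - (1 + theta) * D x.
    by rewrite /rate; case: (x i) => /=; ring.
  have -> : f (flip x i) = f x + D x by rewrite /D addrC subrK.
  have -> : \sum_(j < n | j != i)
        rate (flip x i j) * (f (flip (flip x i) j) - (f x + D x)) =
     \sum_(j < n | j != i) rate (x j) * (f (flip x j) - f x) +
     2 * (E - \sum_(j < n | j != i) D x).
    rewrite -sumrB mulr_sumr -big_split /=; apply: eq_bigr => j ji.
    rewrite flipE (negbTE ji) flipC.
    have -> : f (flip (flip x j) i) = f (flip x j) + D (flip x j).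
      by rewrite /D addrC subrK.
    by field.
  have -> : \sum_(j < n | j != i) D x = (n%:R - 1) * D x.
    by rewrite sumr_const cardC1 card_ord -subn1 -[LHS]mulr_natl natrB.
  by field.
rewrite normrM gtr0_norm ?invr_gt0// mulrC ler_pdivrMr//.
have L0 : 0 <= L by apply: le_trans (fL x).
have rate_ge0 b : 0 <= rate b by case: b => //=; rewrite ltW.
have rate_le1 b : rate b <= 1 by case: b.
have -> : (1 - gap) * L * n%:R = (1 - theta) / 2 * L + (n%:R - 1) * L.
  by rewrite /gap; field.
apply: le_trans (ler_normD _ _) _; apply: lerD.
  have t2 : 0 <= (1 - theta) / 2 by have := theta_le1; lra.
  by rewrite normrM ger0_norm// ler_wpM2l//; exact: fL.
have -> : (n%:R - 1) * L = \sum_(j < n | j != i) L.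
  by rewrite sumr_const cardC1 card_ord -subn1 -[RHS]mulr_natl natrB.
apply: le_trans (ler_norm_sum _ _ _) _; apply: ler_sum => j _.
apply: le_trans (ler_normD _ _) _; rewrite normrM [X in _ + X]normrM.
have r0 := rate_ge0 (x j); have r1 := rate_le1 (x j).
rewrite [`|1 - _|]ger0_norm; last by lra.
rewrite [`|rate _ / 2|]ger0_norm; last by lra.
have -> : L = (1 - rate (x j) / 2) * L + rate (x j) / 2 * L by field.
by apply: lerD; rewrite ler_wpM2l//; try lra; exact: fL.
Qed.

Lemma expect_after_lipschitz f : (forall x i, `|f (flip x i) - f x| <= 1) ->
  forall t x i,
    `|expect_after P t f (flip x i) - expect_after P t f x| <= (1 - gap) ^+ t.
Proof.
move=> f1; elim=> [|t IH] x i; first by rewrite !expect_after0 expr0.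
rewrite !expect_afterS exprS; apply: generator_contract => y; exact: IH.
Qed.

(** Interpolates from [x] to [y] by changing one coordinate at a time. *)
Definition splice (k : nat) x y : state :=
  [ffun j : 'I_n => if (j < k)%N then y j else x j].

Lemma lipschitz_osc f L : (forall x i, `|f (flip x i) - f x| <= L) ->
  forall x y, `|f y - f x| <= n%:R * L.
Proof.
move=> fL x y.
have L0 : 0 <= L by apply: le_trans (fL x (Ordinal n_gt0)).
suff H k : (k <= n)%N -> `|f (splice k x y) - f x| <= k%:R * L.
  have <- : splice n x y = y by apply/ffunP => j; rewrite ffunE ltn_ord.
  exact: H.
elim: k => [_|k IH kn].
  have -> : splice 0 x y = x by apply/ffunP => j; rewrite ffunE.
  by rewrite subrr normr0 mul0r.
pose i := Ordinal kn; rewrite -natr1 mulrDl mul1r [leRHS]addrC.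
apply: le_trans (ler_distD (f (splice k x y)) _ _) _.
apply: lerD; last exact: IH (ltnW kn).
have [xy|xy] := eqVneq (x i) (y i).
  have -> : splice k.+1 x y = splice k x y.
    apply/ffunP => j; rewrite !ffunE ltnS leq_eqVlt; case: eqVneq => //= jk.
    have -> : j = i by exact/val_inj.
    by rewrite /= ltnn.
  by rewrite subrr normr0.
have -> : splice k.+1 x y = flip (splice k x y) i; last exact: fL.
apply/ffunP => j; rewrite flipE !ffunE ltnS leq_eqVlt -(inj_eq val_inj) /=.
case: eqVneq => //= jk; have -> : j = i by exact/val_inj.
by rewrite /= ltnn; move: xy; case: (x i); case: (y i).
Qed.

(** The probability of [A] after [t] steps and its equilibrium probability are
    the value at [x] and, by stationarity, the mean of one function, whose
    oscillation along each coordinate is at most [(1 - gap) ^+ t]. *)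
Lemma worst_dist_contract t : worst_dist P stat t <= n%:R * (1 - gap) ^+ t.
Proof.
have c0 : 0 <= n%:R * (1 - gap) ^+ t.
  by rewrite mulr_ge0// exprn_ge0// subr_ge0 gap_le1.
apply: worst_dist_le => // x; apply: tv_dist_le => // A.
pose f y : R := (y \in A)%:R.
have f1 y i : `|f (flip y i) - f y| <= 1.
  rewrite /f; do 2 case: (_ \in A);
    by rewrite ?subrr ?subr0 ?sub0r ?normrN ?normr1 ?normr0.
rewrite -expect_after_indicator.
have -> : \sum_(y in A) stat y = \sum_y stat y * expect_after P t f y.
  rewrite (expect_after_stationary _ _ product_dist_stationary) big_mkcond.
  by apply: eq_bigr => y _; rewrite /f; case: (y \in A); rewrite ?mulr1 ?mulr0.
set u := expect_after P t f x; set c := n%:R * _ in c0 *.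
have -> : u = \sum_y stat y * u by rewrite -mulr_suml sum_product_dist mul1r.
have -> : c = \sum_y stat y * c by rewrite -mulr_suml sum_product_dist mul1r.
rewrite -sumrB; apply: ler_sum => y _.
rewrite -mulrBr ler_wpM2l//; first exact/ltW/product_dist_gt0.
apply: le_trans (ler_norm _) _; apply: lipschitz_osc => z i.
exact: expect_after_lipschitz.
Qed.

(** * Product eigenfunctions and the L2 bound *)

(** Orthogonal to the constants under [site_weight], hence the second
    eigenfunction of the two-state chain, scaled so that its absolute value is
    at most 1 and its mean square is [theta]. *)
Definition site_eigenfun (b : bool) : R := if b then 1 else - theta.

Definition eigenfun S x : R := \prod_(i in S) site_eigenfun (x i).

(** At a single site, [rate b * (site_eigenfun (~~ b) - site_eigenfun b)] equals
    [- (1 + theta) * site_eigenfun b]. *)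
Lemma eigenfun_flip S x i :
  rate (x i) * (eigenfun S (flip x i) - eigenfun S x) =
  if i \in S then - (1 + theta) * eigenfun S x else 0.
Proof.
case: ifP => iS.
  rewrite /eigenfun !(bigD1 i iS) /= flipE eqxx.
  have -> : \prod_(j in S | j != i) site_eigenfun (flip x i j) =
            \prod_(j in S | j != i) site_eigenfun (x j).
    by apply: eq_bigr => j /andP[_ ji]; rewrite flipE (negbTE ji).
  by rewrite /rate /site_eigenfun; case: (x i) => /=; ring.
apply/eqP; rewrite mulf_eq0 subr_eq0; apply/orP; right; apply/eqP.
apply: eq_bigr => j jS; rewrite flipE; case: eqVneq => // ji.
by rewrite -ji jS in iS.
Qed.

Definition eigenval (k : nat) : R := 1 - k%:R * gap.

Lemma eigenfunP S x :
  \sum_z P x z * eigenfun S z = eigenval #|S| * eigenfun S x.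
Proof.
rewrite generatorE; under eq_bigr do rewrite eigenfun_flip.
rewrite -big_mkcond /= sumr_const -[X in _ * X]mulr_natl /eigenval /gap.
have n0 : n%:R != 0 :> R by rewrite pnatr_eq0 -lt0n.
by field.
Qed.

Lemma expect_after_eigenfun t S x :
  expect_after P t (eigenfun S) x = eigenval #|S| ^+ t * eigenfun S x.
Proof. exact/expect_after_eigen/eigenfunP. Qed.

Lemma expect_eigenfun2 S S' :
  \sum_x stat x * (eigenfun S x * eigenfun S' x) = (S == S')%:R * theta ^+ #|S|.
Proof.
pose G i b : R := (if i \in S then site_eigenfun b else 1) *
  (if i \in S' then site_eigenfun b else 1).
have t1 := theta1_neq0.
transitivity (\sum_x stat x * \prod_i G i (x i)).
  apply: eq_bigr => x _; rewrite /eigenfun.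
  by rewrite big_mkcond [X in _ * (_ * X) = _]big_mkcond -big_split.
rewrite expect_prod /G /site_weight /site_eigenfun.
have [<-|SS'] := eqVneq S S'.
  rewrite -[true%:R]/(1 : R) [RHS]mul1r -prodr_const [RHS]big_mkcond.
  apply: eq_bigr => i _.
  by case: ifP => _; field.
rewrite -[false%:R]/(0 : R) [RHS]mul0r; apply/eqP; rewrite prodf_seq_eq0; apply/hasP.
have : ~~ [forall i, (i \in S) == (i \in S')].
  by apply: contra SS' => /forallP SS'; apply/eqP/setP => i; exact/eqP.
rewrite negb_forall => /existsP[i iSS']; exists i; first exact: mem_index_enum.
by move: iSS'; case: (i \in S); case: (i \in S') => //= _; apply/eqP; field.
Qed.

Lemma expect_eigenfun S : S != finset.set0 -> \sum_x stat x * eigenfun S x = 0.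
Proof.
move=> S0; have := expect_eigenfun2 S finset.set0.
rewrite (negbTE S0) mul0r => /esym S00; rewrite [RHS]S00.
by apply: eq_bigr => x _; rewrite [eigenfun finset.set0 x]big_set0 mulr1.
Qed.

(** Expansion of a point mass in the eigenbasis: at one site,
    [1 + theta^-1 * site_eigenfun a * site_eigenfun b] vanishes when [a] and [b]
    differ and is [(site_weight a)^-1] otherwise; multiply over the sites and
    expand the product over subsets. *)
Lemma indicator_eigenfun x y : (x == y)%:R =
  stat y * \sum_(S in {set 'I_n}) theta ^- #|S| * eigenfun S y * eigenfun S x.
Proof.
have t0 : theta != 0 by rewrite gt_eqF.
have t1 := theta1_neq0.
transitivity (\prod_i (site_weight (y i) *
    (theta^-1 * site_eigenfun (y i) * site_eigenfun (x i) + 1))).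
  have sE i : site_weight (y i) *
      (theta^-1 * site_eigenfun (y i) * site_eigenfun (x i) + 1) = (x i == y i)%:R.
    rewrite /site_weight /site_eigenfun.
    by case: (x i); case: (y i) => /=; field; rewrite ?t0.
  under eq_bigr do rewrite sE.
  have [->|xy] := eqVneq x y; first by rewrite big1// => i _; rewrite eqxx.
  apply/esym/eqP; rewrite prodf_seq_eq0; apply/hasP.
  have : ~~ [forall i, x i == y i].
    by apply: contra xy => /forallP xy; apply/eqP/ffunP => i; exact/eqP.
  rewrite negb_forall => /existsP[i xyi]; exists i; first exact: mem_index_enum.
  by rewrite /= (negbTE xyi) /= eqxx.
rewrite big_split /= -product_distE; congr (_ * _).
rewrite bigA_distr; apply: eq_bigr => S _.
rewrite -big_mkcond /= !big_split /= prodr_const exprVn //.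
Qed.

Lemma transition_power_eigenfun t x y : transition_power P t x y =
  stat y * \sum_(S in {set 'I_n})
    theta ^- #|S| * eigenfun S y * (eigenval #|S| ^+ t * eigenfun S x).
Proof.
have -> : transition_power P t x y = expect_after P t (fun z => (z == y)%:R) x.
  have := expect_after_indicator P t [set y]%SET x; rewrite big_set1 => <-.
  by apply: eq_expect_after => z; rewrite inE.
under eq_expect_after do rewrite indicator_eigenfun.
rewrite expect_afterZ expect_after_sum; congr (_ * _); apply: eq_bigr => S _.
by rewrite expect_afterZ expect_after_eigenfun.
Qed.

(** Cauchy-Schwarz, obtained by expanding the square of [g] centered at [e], the
    left-hand integral. *)
Lemma sqr_expect_le (g : state -> R) A :
  (\sum_(y in A) stat y * g y) ^+ 2 <= \sum_y stat y * g y ^+ 2.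
Proof.
have s0 y : 0 <= stat y by exact/ltW/product_dist_gt0.
have [e eE] : exists e, e = \sum_(y in A) stat y * g y by eexists.
rewrite -eE.
apply: (@le_trans _ _ (\sum_(y in A) stat y * g y ^+ 2)); last first.
  rewrite [leLHS]big_mkcond; apply: ler_sum => y _.
  by case: ifP => // _; rewrite mulr_ge0 ?sqr_ge0.
have sA : \sum_(y in A) stat y <= 1.
  rewrite -sum_product_dist [leLHS]big_mkcond; apply: ler_sum => y _.
  by case: ifP.
have : 0 <= \sum_(y in A) stat y * (g y - e) ^+ 2.
  by apply: sumr_ge0 => y _; rewrite mulr_ge0 ?sqr_ge0.
have -> : \sum_(y in A) stat y * (g y - e) ^+ 2 =
  \sum_(y in A) stat y * g y ^+ 2 - 2 * e * (\sum_(y in A) stat y * g y) +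
  e ^+ 2 * \sum_(y in A) stat y.
  rewrite !mulr_sumr -sumrB -big_split /=; apply: eq_bigr => y _; ring.
by have := sqr_ge0 e; rewrite -eE; nra.
Qed.

Lemma eigenval_bounds k : (k <= n)%N -> 0 <= eigenval k <= expR (- (k%:R * gap)).
Proof.
move=> kn; rewrite expR_ge1Dx andbT subr_ge0.
rewrite /gap mulrA ler_pdivrMr ?mulr_gt0 ?ltr0n// mul1r.
have : k%:R <= n%:R :> R by rewrite ler_nat.
have : 0 <= k%:R :> R by [].
have := theta_le1; have := theta_gt0; nra.
Qed.

Lemma norm_eigenfun_le1 S x : `|eigenfun S x| <= 1.
Proof.
rewrite /eigenfun normr_prod; apply: prodr_ile1 => i _.
rewrite normr_ge0 /site_eigenfun; case: (x i) => //=; first by rewrite normr1.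
by rewrite normrN gtr0_norm.
Qed.

(** By Cauchy-Schwarz and orthogonality, the squared distance is at most the sum
    over nonempty [S] of [theta ^- #|S| * eigenval #|S| ^+ (2 * t)], where the
    eigenfunctions at the starting point have been bounded by 1. As
    [eigenval k <= expR (- (k * gap))], this is at most the sum of [q ^+ #|S|]
    for [q = expR (- (2 * t * gap)) / theta], which is [(1 + q) ^+ n - 1]. *)
Lemma worst_dist_spectral t :
  worst_dist P stat t <=
  Num.sqrt (expR (n%:R * (expR (- (2 * t%:R * gap)) / theta)) - 1).
Proof.
have t0 : theta != 0 by rewrite gt_eqF.
apply: worst_dist_le => [|x]; first exact: sqrtr_ge0.
apply: tv_dist_le => [|A]; first exact: sqrtr_ge0.
set q := _ / theta; have q0 : 0 <= q by rewrite divr_ge0 ?expR_ge0// ltW.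
(* g is the density with respect to stat, minus 1; c S are its coefficients. *)
pose c S := theta ^- #|S| * (eigenval #|S| ^+ t * eigenfun S x).
pose g y := \sum_(S in {set 'I_n} | S != finset.set0) c S * eigenfun S y.
have -> : \sum_(y in A) transition_power P t x y - \sum_(y in A) stat y =
    \sum_(y in A) stat y * g y.
  rewrite -sumrB; apply: eq_bigr => y _; rewrite transition_power_eigenfun.
  rewrite (bigD1 finset.set0)//= cards0 expr0 invr1 /eigenval mul0r subr0.
  rewrite expr1n ![eigenfun finset.set0 _]big_set0 !mulr1 mulrDr mulr1.
  rewrite addrAC subrr add0r; congr (_ * _); apply: eq_bigr => S _.
  by rewrite /c; ring.
apply: le_trans (ler_norm _) _; rewrite -sqrtr_sqr; apply: ler_wsqrtr.
apply: le_trans (sqr_expect_le g A) _.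
have -> : \sum_y stat y * g y ^+ 2 =
    \sum_(S in {set 'I_n} | S != finset.set0) c S ^+ 2 * theta ^+ #|S|.
  under eq_bigr do rewrite expr2 {1}/g mulr_suml mulr_sumr.
  rewrite exchange_big; apply: eq_bigr => S SP /=.
  under eq_bigr do rewrite /g !mulr_sumr.
  rewrite exchange_big (bigD1 S SP) /= [X in _ + X]big1 ?addr0 => [|S' /andP[_ SS']].
    transitivity (c S ^+ 2 * \sum_y stat y * (eigenfun S y * eigenfun S y)).
      by rewrite mulr_sumr; apply: eq_bigr => y _; ring.
    by rewrite expect_eigenfun2 eqxx mul1r.
  transitivity (c S * c S' * \sum_y stat y * (eigenfun S y * eigenfun S' y)).
    by rewrite mulr_sumr; apply: eq_bigr => y _; ring.
  by rewrite expect_eigenfun2 eq_sym (negbTE SS') mul0r mulr0.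
apply: (@le_trans _ _ (\sum_(S in {set 'I_n} | S != finset.set0) q ^+ #|S|)).
  apply: ler_sum => S _.
  have -> : c S ^+ 2 * theta ^+ #|S| =
     theta ^- #|S| * (eigenval #|S| ^+ t) ^+ 2 * eigenfun S x ^+ 2.
    by rewrite /c; field; rewrite expf_neq0.
  have /eigenval_bounds/andP[l0 l1] : (#|S| <= n)%N.
    by rewrite -[leqRHS]card_ord max_card.
  rewrite /q expr_div_n [leRHS]mulrC -[leRHS]mulr1.
  have ti : 0 <= theta ^- #|S| by rewrite invr_ge0 exprn_ge0// (ltW theta_gt0).
  apply: ler_pM; [by rewrite (mulr_ge0 ti)// sqr_ge0|exact: sqr_ge0| |].
    rewrite ler_wpM2l//.
    rewrite -exprM -expRM_natl.
    have -> : #|S|%:R * - (2 * t%:R * gap) = (t * 2)%:R * - (#|S|%:R * gap).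
      by rewrite natrM; ring.
    by rewrite expRM_natl; apply: lerXn2r => //; rewrite nnegrE expR_ge0.
  by rewrite -real_normK ?num_real// expr_le1// norm_eigenfun_le1.
have -> : \sum_(S in {set 'I_n} | S != finset.set0) q ^+ #|S| = (1 + q) ^+ n - 1.
  have -> : (1 + q) ^+ n = \prod_(i < n) (q + 1).
    by rewrite prodr_const card_ord addrC.
  rewrite bigA_distr [X in _ = X - _](bigD1 finset.set0)//=.
  rewrite [X in _ = X + _ - _]big1 => [|i _]; last by rewrite inE.
  rewrite addrAC subrr add0r.
  by apply: eq_bigr => S _; rewrite -big_mkcond /= prodr_const.
rewrite lerB// expRM_natl lerXn2r ?nnegrE ?expR_ge0 ?addr_ge0//.
exact: expR_ge1Dx.
Qed.

(** * The sum of the site eigenfunctions, started from all ones *)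

Definition deviation x : R := \sum_i site_eigenfun (x i).

Lemma eigenfun1 i x : eigenfun [set i]%SET x = site_eigenfun (x i).
Proof. by rewrite /eigenfun big_set1. Qed.

(** The square is again a combination of eigenfunctions, as
    [site_eigenfun b ^+ 2 = theta + (1 - theta) * site_eigenfun b]; its mean at
    any time is then explicit. *)
Lemma deviation_sqr x : deviation x ^+ 2 =
  n%:R * theta + (1 - theta) * \sum_i eigenfun [set i]%SET x +
  \sum_i \sum_(j | j != i) eigenfun (i |: [set j])%SET x.
Proof.
under eq_bigr do rewrite eigenfun1.
under [X in _ = _ + X]eq_bigr => i _.
  under eq_bigr => j ji.
    rewrite /eigenfun big_setU1 ?big_set1; last by rewrite inE eq_sym.
    over.
  rewrite -mulr_sumr.
  over.
rewrite mulr_sumr.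
have -> : n%:R * theta = \sum_(i < n) theta by rewrite sumr_const card_ord mulr_natl.
rewrite -!big_split /= expr2 {1}/deviation mulr_suml; apply: eq_bigr => i _.
rewrite /deviation (bigD1 i)//= mulrDr; congr (_ + _).
by rewrite /site_eigenfun; case: (x i); ring.
Qed.

Definition all_ones : state := [ffun=> true].

Lemma eigenfun_all_ones S : eigenfun S all_ones = 1.
Proof. by rewrite /eigenfun big1// => i _; rewrite ffunE. Qed.

Lemma sum_pairs (c : R) : \sum_(i < n) \sum_(j < n | j != i) c = n%:R * (n%:R - 1) * c.
Proof.
have E i : \sum_(j < n | j != i) c = (n%:R - 1) * c.
  by rewrite sumr_const cardC1 card_ord -subn1 -[LHS]mulr_natl natrB.
by under eq_bigr do rewrite E; rewrite sumr_const card_ord -[LHS]mulr_natl mulrA.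
Qed.

Lemma expect_deviation_sqr : \sum_x stat x * deviation x ^+ 2 = n%:R * theta.
Proof.
have z1 i : \sum_x stat x * eigenfun [set i]%SET x = 0.
  by apply: expect_eigenfun; rewrite -cards_eq0 cards1.
have z2 i j : \sum_x stat x * eigenfun (i |: [set j])%SET x = 0.
  by apply: expect_eigenfun; apply/set0Pn; exists i; rewrite !inE eqxx.
under eq_bigr do rewrite deviation_sqr !mulrDr.
rewrite !big_split /= -mulr_suml sum_product_dist mul1r -[RHS]addr0 -addrA.
congr (_ + _); rewrite [X in _ + X](_ : _ = 0) ?addr0.
  under eq_bigr do rewrite mulrCA mulr_sumr.
  by rewrite -mulr_sumr exchange_big big1 ?mulr0.
under eq_bigr do rewrite mulr_sumr; rewrite exchange_big big1// => i _.
under eq_bigr do rewrite mulr_sumr.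
by rewrite exchange_big big1.
Qed.

Lemma expect_after_deviation t :
  expect_after P t deviation all_ones = n%:R * (1 - gap) ^+ t.
Proof.
have -> : expect_after P t deviation all_ones =
    expect_after P t (fun y => \sum_i eigenfun [set i]%SET y) all_ones.
  by apply: eq_expect_after => y; apply: eq_bigr => i _; rewrite eigenfun1.
rewrite expect_after_sum.
under eq_bigr do rewrite expect_after_eigenfun eigenfun_all_ones cards1 mulr1.
by rewrite sumr_const card_ord -[LHS]mulr_natl /eigenval mul1r.
Qed.

(** The off-diagonal terms decay like [eigenval 2 ^+ t], and
    [eigenval 2 <= (1 - gap) ^+ 2]: the coordinates are negatively correlated, so
    that only the diagonal terms contribute to the bound on the variance. *)
Lemma expect_after_deviation_sqr t : (1 < n)%N ->
  expect_after P t (fun y => (deviation y - n%:R * (1 - gap) ^+ t) ^+ 2) all_ones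
  <= n%:R * theta + n%:R * (1 - gap) ^+ t.
Proof.
move=> n2; move mE : (n%:R * (1 - gap) ^+ t) => m.
have m0 : 0 <= m by rewrite -mE mulr_ge0// exprn_ge0// subr_ge0 gap_le1.
have E1 c : expect_after P t (fun=> c) all_ones = c.
  exact: (expect_after_const t c all_ones lazy_metropolis_sum1).
have -> : expect_after P t (fun y => (deviation y - m) ^+ 2) all_ones =
  n%:R * theta + (1 - theta) * m + n%:R * (n%:R - 1) * eigenval 2 ^+ t - m ^+ 2.
  have -> : expect_after P t (fun y => (deviation y - m) ^+ 2) all_ones =
    expect_after P t (fun y => (n%:R * theta + m ^+ 2) +
      ((1 - theta) * \sum_i eigenfun [set i]%SET y +
      (\sum_i \sum_(j | j != i) eigenfun (i |: [set j])%SET y +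
      (- (2 * m)) * deviation y))) all_ones.
    by apply: eq_expect_after => y; rewrite sqrrB deviation_sqr; ring.
  rewrite !expect_afterD !E1 !expect_afterZ expect_after_deviation mE.
  have -> : expect_after P t (fun y => \sum_i eigenfun [set i]%SET y) all_ones = m.
    rewrite -mE -expect_after_deviation; apply: eq_expect_after => y.
    by apply: eq_bigr => i _; rewrite eigenfun1.
  have -> : expect_after P t (fun y =>
      \sum_i \sum_(j | j != i) eigenfun (i |: [set j])%SET y) all_ones =
      \sum_(i < n) \sum_(j < n | j != i) eigenval 2 ^+ t.
    rewrite expect_after_sum; apply: eq_bigr => i _.
    rewrite expect_after_sum; apply: eq_bigr => j ji.
    by rewrite expect_after_eigenfun eigenfun_all_ones cards2 eq_sym ji mulr1.
  by rewrite sum_pairs; ring.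
have ev2 : eigenval 2 ^+ t <= ((1 - gap) ^+ t) ^+ 2.
  have /andP[l0 _] := eigenval_bounds n2.
  rewrite exprAC; apply: lerXn2r; rewrite ?nnegrE ?sqr_ge0//.
  rewrite /eigenval -subr_ge0.
  have -> : (1 - gap) ^+ 2 - (1 - 2 * gap) = gap ^+ 2 by ring.
  exact: sqr_ge0.
have n1 : 1 <= n%:R :> R by rewrite ler1n.
have /andP[l0 _] := eigenval_bounds n2.
have e0 : 0 <= eigenval 2 ^+ t by rewrite exprn_ge0.
have h1 : n%:R * (n%:R - 1) * eigenval 2 ^+ t <= m ^+ 2.
  rewrite -mE exprMn; apply: ler_pM => //.
    by rewrite mulr_ge0// subr_ge0.
  by rewrite expr2 ler_wpM2l// lerBlDr lerDl.
have := theta_gt0.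
nra.
Qed.

Lemma worst_dist_lower t m : (1 < n)%N -> gap < 1 -> m = n%:R * (1 - gap) ^+ t ->
  1 - 4 * (2 * (n%:R * theta) + m) / m ^+ 2 <= worst_dist P stat t.
Proof.
move=> n2 g1 mE; apply: le_trans (worst_dist_ge P stat t all_ones).
have -> : 2 * (n%:R * theta) + m = (n%:R * theta + m) + n%:R * theta by ring.
apply: (@tv_dist_chebyshev _ _ _ _ deviation).
- by rewrite mE mulr_gt0 ?ltr0n// exprn_gt0// subr_gt0.
- by move=> x; apply: transition_power_ge0; exact: lazy_metropolis_ge0.
- by move=> x; exact/ltW/product_dist_gt0.
- exact: (transition_power_sum1 t all_ones lazy_metropolis_sum1).
- by rewrite mE; exact: expect_after_deviation_sqr.
- by rewrite expect_deviation_sqr.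
Qed.

(** * Bounds at distance [a n] from the cutoff time *)

Definition log_min : R := Num.min (ln n%:R) (ln (Num.sqrt (n%:R / theta))).

Definition cutoff_time : R := 2 / (1 + theta) * n%:R * log_min.

Let n0 : n%:R != 0 :> R. Proof. by rewrite pnatr_eq0 -lt0n. Qed.
Let n1 : 0 < n%:R :> R. Proof. by rewrite ltr0n. Qed.

Lemma cutoff_time_gap : cutoff_time * gap = log_min.
Proof. by rewrite /cutoff_time /gap; field; rewrite n0 theta1_neq0. Qed.

Lemma gap_gt0 : 0 < gap.
Proof. by rewrite divr_gt0 ?theta1_gt0// mulr_gt0. Qed.

Lemma gap_size : 2^-1 <= n%:R * gap <= 1.
Proof.
have -> : n%:R * gap = (1 + theta) / 2 by rewrite /gap; field.
have := theta_le1; have := theta_gt0; lra.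
Qed.

(** The contraction bound serves when the minimum is [ln n], and the spectral
    bound otherwise; in both cases the time is chosen so that the prefactor
    [n] or [n / theta] is exactly compensated. *)
Lemma worst_dist_after a : 2 <= a ->
  worst_dist_real P stat (cutoff_time + a * n%:R) <= expR ((3 - a) / 2).
Proof.
move=> a2; rewrite /worst_dist_real; move tE : (Num.truncn _) => t.
have g0 := gap_gt0; have g1 := gap_le1; have /andP[ng0 ng1] := gap_size.
(* Rounding the time down costs one step, that is at most gap <= 1. *)
have tgap : log_min + a / 2 - 1 <= t%:R * gap.
  have st : cutoff_time + a * n%:R <= t%:R + 1.
    by rewrite natr1 ltW// -tE truncnS_gt.
  have : (cutoff_time + a * n%:R) * gap <= (t%:R + 1) * gap by rewrite ler_pM2r.
  rewrite !mulrDl cutoff_time_gap mul1r -mulrA; nra.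
have [lnn|lnsqrt] := leP (ln n%:R) (ln (Num.sqrt (n%:R / theta))).
  have lE : log_min = ln n%:R by exact/min_idPl.
  apply: le_trans (worst_dist_contract t) _.
  apply: (@le_trans _ _ (n%:R * expR (- (t%:R * gap)))).
    rewrite ler_wpM2l// -[- (_ * gap)]mulrN expRM_natl; apply: lerXn2r.
    - by rewrite nnegrE subr_ge0.
    - by rewrite nnegrE expR_ge0.
    - exact: expR_ge1Dx.
  rewrite -{1}(lnK n1) -expRD ler_expR -lE; lra.
have lE : log_min = ln (Num.sqrt (n%:R / theta)) by exact/min_idPr/ltW.
have r0 : 0 < n%:R / theta by rewrite divr_gt0.
have elog : expR (2 * log_min) = n%:R / theta.
  by rewrite expRM_natl lE lnK ?posrE ?sqrtr_gt0// sqr_sqrtr// ltW.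
apply: le_trans (worst_dist_spectral t) _.
have -> : expR ((3 - a) / 2) = Num.sqrt (expR (3 - a)).
  have -> : expR (3 - a) = expR ((3 - a) / 2) ^+ 2.
    by rewrite -expRM_natl; congr expR; field.
  by rewrite sqrtr_sqr ger0_norm ?expR_ge0.
apply: ler_wsqrtr.
have wE : n%:R * (expR (- (2 * t%:R * gap)) / theta) <= expR (2 - a).
  rewrite mulrCA -elog -expRD ler_expR; lra.
set w := n%:R * _ in wE *.
(* The hypothesis 2 <= a is what makes expR w - 1 comparable with w. *)
have w1 : w <= 1.
  by apply: le_trans wE _; rewrite -[leRHS]expR0 ler_expR subr_le0.
have w0 : 0 <= w by rewrite mulr_ge0// divr_ge0 ?expR_ge0// ltW.
have e1 : expR w - 1 <= w * expR w.
  have := ler_wpM2r (expR_ge0 w) (expR_ge1Dx (- w)).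
  by rewrite -expRD addNr expR0; lra.
apply: le_trans e1 _.
have -> : 3 - a = (2 - a) + 1 by ring.
by rewrite expRD; apply: ler_pM => //; rewrite ?expR_ge0// ler_expR.
Qed.

(** Makes the cutoff time of larger order than [n], as [theta <= 1]. *)
Lemma log_min_ge : ln n%:R / 2 <= log_min.
Proof.
have ln0 : 0 <= ln n%:R :> R by rewrite ln_ge0// ler1n.
have r0 : 0 < n%:R / theta by rewrite divr_gt0.
rewrite /log_min le_min; apply/andP; split; first lra.
rewrite -ler_expR lnK ?posrE ?sqrtr_gt0//.
rewrite -(@ler_pXn2r _ 2)// ?nnegrE ?expR_ge0 ?sqrtr_ge0// sqr_sqrtr ?(ltW r0)//.
rewrite -expRM_natl mulrCA divff// mulr1 lnK ?posrE//.
by rewrite ler_pdivlMr// -[leRHS]mulr1 ler_pM2l.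
Qed.

Lemma cutoff_time_ge a : 2 * a <= ln n%:R -> a * n%:R <= cutoff_time.
Proof.
move=> an; have lm := log_min_ge.
have ln0 : 0 <= ln n%:R :> R by rewrite ln_ge0// ler1n.
have -> : cutoff_time = (2 / (1 + theta) * log_min) * n%:R.
  by rewrite /cutoff_time mulrAC.
rewrite ler_wpM2r// mulrAC ler_pdivlMr ?theta1_gt0//.
have := theta_le1; have := theta_gt0; nra.
Qed.

(** With [h] the value of [n * expR (- log_min)], the definition of the minimum
    says exactly that [h >= 1] and [h ^+ 2 >= n * theta]; the mean of the
    deviation exceeds [h] by the factor [b], large with [a]. The hypothesis
    [2 * a <= ln n] keeps the time nonnegative. *)
Lemma worst_dist_before a : (1 < n)%N -> 4 <= a -> 2 * a <= ln n%:R ->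
  1 - 12 * expR (2 - a / 2) <= worst_dist_real P stat (cutoff_time - a * n%:R).
Proof.
move=> n2 a4 an; rewrite /worst_dist_real; move tE : (Num.truncn _) => t.
have g0 := gap_gt0; have g1 := gap_le1; have /andP[ng0 ng1] := gap_size.
have n2R : 2 <= n%:R :> R by rewrite ler_nat.
have g2 : gap <= 2^-1.
  by nra.
have g1' : 0 < 1 - gap by lra.
have lm := log_min_ge.
have ln0 : 0 <= ln n%:R :> R by rewrite ln_ge0// ler1n.
have lmn : log_min <= n%:R.
  by apply: (@le_trans _ _ (ln n%:R)); [rewrite ge_min lexx|exact/ltW/ln_sublinear].
have tgap : t%:R * gap <= log_min - a / 2.
  have st : t%:R <= cutoff_time - a * n%:R.
    by rewrite -tE truncn_le subr_ge0 cutoff_time_ge.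
  have : t%:R * gap <= (cutoff_time - a * n%:R) * gap by rewrite ler_pM2r.
  rewrite mulrBl cutoff_time_gap -mulrA; nra.
have tg0 : 0 <= t%:R * gap by rewrite mulr_ge0// ltW.
pose h := n%:R * expR (- log_min).
pose b := expR (a / 2 - 2).
have h1 : 1 <= h.
  by rewrite /h expRN ler_pdivlMr ?expR_gt0// mul1r -[leRHS]lnK// ler_expR ge_min lexx.
have r0 : 0 < n%:R / theta by rewrite divr_gt0.
have h2 : n%:R * theta <= h ^+ 2.
  have e2 : expR log_min ^+ 2 <= n%:R / theta.
    rewrite -[leRHS]sqr_sqrtr ?(ltW r0)//; apply: lerXn2r.
    - by rewrite nnegrE expR_ge0.
    - by rewrite nnegrE sqrtr_ge0.
    - by rewrite -[leRHS]lnK ?posrE ?sqrtr_gt0// ler_expR ge_min lexx orbT.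
  rewrite /h expRN exprMn exprVn ler_pdivlMr ?exprn_gt0 ?expR_gt0//.
  apply: (@le_trans _ _ (n%:R * theta * (n%:R / theta))).
    by rewrite ler_wpM2l// mulr_ge0// ltW.
  by rewrite mulrACA divff ?gt_eqF// mulr1 expr2.
have [m mE] : exists m, m = n%:R * (1 - gap) ^+ t by eexists.
(* From expR (- gap / (1 - gap)) <= 1 - gap. Replacing gap / (1 - gap) by gap in
   the exponent costs at most 2 * t * gap ^+ 2 <= 2 in total, which is the
   constant 2 in b; here t * gap <= ln n <= n and n * gap <= 1. *)
have bm : b * h <= m.
  rewrite mE /b /h mulrCA ler_wpM2l// -expRD.
  have g3 : expR (- (gap / (1 - gap))) <= 1 - gap.
    rewrite expRN -[leLHS]mul1r ler_pdivrMr ?expR_gt0//.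
    have := ler_wpM2l (ltW g1') (expR_ge1Dx (gap / (1 - gap))).
    by rewrite mulrDr mulr1 mulrCA divff ?gt_eqF// mulr1 subrK.
  apply: (@le_trans _ _ (expR (- (gap / (1 - gap))) ^+ t)); last first.
    by apply: lerXn2r; rewrite ?nnegrE ?expR_ge0// subr_ge0.
  rewrite -expRM_natl ler_expR.
  have gg : gap / (1 - gap) <= gap + 2 * gap ^+ 2.
    by rewrite ler_pdivrMr; [nra|lra].
  have : t%:R * (gap / (1 - gap)) <= t%:R * (gap + 2 * gap ^+ 2) by rewrite ler_wpM2l.
  have : t%:R * gap * gap <= 1.
    apply: le_trans ng1; rewrite ler_pM2r//; lra.
  rewrite mulrDr expr2; nra.
have b0 : 0 < b by exact: expR_gt0.
have m0 : 0 < m by apply: lt_le_trans bm; rewrite mulr_gt0//; lra.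
have gl1 : gap < 1 by lra.
apply: le_trans (worst_dist_lower n2 gl1 mE).
have bE : expR (2 - a / 2) = b^-1 by rewrite /b -expRN; congr expR; ring.
have bV1 : b^-1 <= 1 by rewrite -bE -[leRHS]expR0 ler_expR; lra.
rewrite bE lerB// ler_pdivrMr ?exprn_gt0//.
have bV0 : 0 < b^-1 by rewrite invr_gt0.
have hm : h <= b^-1 * m by rewrite mulrC ler_pdivlMr// mulrC.
have h0 : 0 <= h by lra.
have mh : m <= b^-1 * m ^+ 2.
  rewrite expr2 mulrA -[leLHS]mul1r ler_pM2r//; lra.
have nth : n%:R * theta <= b^-1 * m ^+ 2.
  apply: le_trans h2 _.
  apply: (@le_trans _ _ ((b^-1 * m) ^+ 2)).
    by apply: lerXn2r; rewrite ?nnegrE//; apply: le_trans hm.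
  rewrite exprMn expr2 -mulrA ler_pM2l//.
  by rewrite -[leRHS]mul1r ler_wpM2r ?sqr_ge0.
lra.
Qed.
End Cube.

(** * Passage to the limit *)

Section Limits.
Variable R : realType.
Implicit Types (u : nat -> \bar R) (c : \bar R).

Lemma limn_esup_le_near u c :
  (\forall n \near \oo, (u n <= c)%E) -> (limn_esup u <= c)%E.
Proof.
move=> uc; rewrite /limn_esup limf_esupE.
apply: (@le_trans _ _ (ereal_sup [set u n | n in [set n | (u n <= c)%E]])).
  by apply: ereal_inf_lbound; exists [set n | (u n <= c)%E].
by apply: ge_ereal_sup => _ [n /= un <-].
Qed.

Lemma limn_esup_ge_near u c :
  (\forall n \near \oo, (c <= u n)%E) -> (c <= limn_esup u)%E.
Proof.
move=> uc; rewrite /limn_esup limf_esupE.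
apply: le_ereal_inf_tmp => _ [V Voo <-].
have [n [cn Vn]] : exists n, (c <= u n)%E /\ V n.
  have /filter_ex[n [? ?]] : \forall n \near \oo, (c <= u n)%E /\ V n by exact: filterI.
  by exists n.
by apply: le_trans cn _; apply: ereal_sup_ubound; exists n.
Qed.

Lemma limn_einf_ge_near u c :
  (\forall n \near \oo, (c <= u n)%E) -> (c <= limn_einf u)%E.
Proof.
move=> uc; rewrite /limn_einf leeNr; apply: limn_esup_le_near.
by apply: filterS uc => n; rewrite leeN2.
Qed.

Lemma limn_einf_le_near u c :
  (\forall n \near \oo, (u n <= c)%E) -> (limn_einf u <= c)%E.
Proof.
move=> uc; rewrite /limn_einf leeNl; apply: limn_esup_ge_near.
by apply: filterS uc => n; rewrite leeN2.
Qed.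

(** The profile of both bounds, as a function of the position in the window. *)
Lemma cvg_expR_sub_half (c : R) : expR (c - a / 2) @[a --> +oo] --> 0.
Proof.
under eq_fun do rewrite expRD.
suff : expR c * expR (- (a / 2)) @[a --> +oo] --> expR c * 0 by rewrite mulr0.
apply: cvgM; first exact: cvg_cst.
apply: (@cvg_comp _ _ _ (fun a : R => a / 2) (fun a => expR (- a)) _ +oo%R); last first.
  exact: cvgr_expR.
by apply: gt0_cvgMly => //; exact: cvg_id.
Qed.

Lemma near_ln_nat_ge (c : R) : \forall n \near \oo, c <= ln (n%:R : R).
Proof.
near=> n.
rewrite -ler_expR lnK; last by rewrite posrE ltr0n; near: n; exact: nbhs_infty_gt.
by near: n; exact: nbhs_infty_ger.
Unshelve. all: end_near. Qed.

End Limits.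

Theorem theorem21 (R : realType) (theta : nat -> R)
    (theta_gt0_le1 : forall n : nat, (1 <= n)%N -> 0 < theta n <= 1) :
  has_cutoff
    (T := fun n : nat => {ffun 'I_n -> bool})
    (fun n : nat => lazy_metropolis (product_dist (n := n) (theta n)))
    (fun n : nat => product_dist (n := n) (theta n))
    (fun n : nat => 2 / (1 + theta n) * n%:R *
       Num.min (ln n%:R) (ln (Num.sqrt (n%:R / theta n))))
    (fun n : nat => n%:R).
Proof.
have theta_gt0 n : (0 < n)%N -> 0 < theta n by move=> /theta_gt0_le1/andP[].
have theta_le1 n : (0 < n)%N -> theta n <= 1 by move=> /theta_gt0_le1/andP[].
have dist_le1 n t : (0 < n)%N ->
    worst_dist (lazy_metropolis (product_dist (n := n) (theta n)))
      (product_dist (theta n)) t <= 1.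
  move=> n0; apply: worst_dist_le1.
  - by move=> x; apply/ltW/product_dist_gt0 => //; exact: theta_gt0.
  - by move=> x y; apply: lazy_metropolis_ge0 => //; exact: theta_gt0.
  - by move=> x; apply: lazy_metropolis_sum1 => //; [exact: theta_gt0|exact: theta_le1].
split.
- apply/eqoP => e e0; near=> n.
  have n0 : (0 < n)%N by near: n; exact: nbhs_infty_gt.
  have ln_ge : 2 * e^-1 <= ln (n%:R : R) by near: n; exact: near_ln_nat_ge.
  have := cutoff_time_ge n0 (theta_gt0 _ n0) (theta_le1 _ n0) ln_ge.
  rewrite -[_^-1 * _]mulrC ler_pdivrMr// ger0_norm// => /le_trans; apply.
  by rewrite mulrC ler_pM2l// ler_norm.
- apply: (@squeeze_cvge _ _ _ _
    (fun a => (1 - 12 * expR (2 - a / 2))%:E) _ (fun=> 1%E)).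
  + near=> a; apply/andP; split.
      apply: limn_einf_ge_near; near=> n; rewrite lee_fin.
      have n2 : (1 < n)%N by near: n; exact: nbhs_infty_gt.
      have n0 := ltnW n2.
      apply: (worst_dist_before n0 (theta_gt0 _ n0) (theta_le1 _ n0) n2).
      * by near: a; exact: nbhs_pinfty_ge.
      * by near: n; exact: near_ln_nat_ge.
    apply: limn_einf_le_near; near=> n; rewrite lee_fin.
    by apply: dist_le1; near: n; exact: nbhs_infty_gt.
  + apply: cvg_EFin; first exact: nearW.
    suff : 1 - 12 * expR (2 - a / 2) @[a --> +oo] --> (1 - 12 * 0 : R).
      by rewrite mulr0 subr0.
    apply: cvgB; first exact: cvg_cst.
    by apply: cvgM; [exact: cvg_cst|exact: cvg_expR_sub_half].
  + exact: cvg_cst.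
- apply: (@squeeze_cvge _ _ _ _ (fun=> 0%E) _ (fun a => (expR (3 / 2 - a / 2))%:E)).
  + near=> a; apply/andP; split.
      apply: limn_esup_ge_near; near=> n; rewrite lee_fin.
      exact: worst_dist_ge0.
    apply: limn_esup_le_near; near=> n; rewrite lee_fin -mulrBl.
    have n0 : (0 < n)%N by near: n; exact: nbhs_infty_gt.
    apply: (worst_dist_after n0 (theta_gt0 _ n0) (theta_le1 _ n0)).
    by near: a; exact: nbhs_pinfty_ge.
  + exact: cvg_cst.
  + apply: cvg_EFin; first exact: nearW.
    exact: cvg_expR_sub_half.
Unshelve. all: end_near. Qed.
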